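(* Let $(X,d)$ be a compact metric space with a fixed sequence of covers $(K_n)$ as in the context, let $G\le \mathrm{Homeo}(X)$ be a closed subgroup, and let $\mathbf L$ be a sub-paracategory with $\mathtt I\subseteq \mathbf L\subseteq \mathbf K_G$ such that $G_{\mathbf L}$ is a dense subset of $G$. Then the paracategory of digraphs $\underline{\mathbf L}$ is directed if and only if $G$ has a dense conjugacy class.
   Context: **Relations.** For $R\subseteq A\times B$ and $S\subseteq B\times C$, $R\circ S=\{(a,c):\exists b\,(aRb \text{ and } bSc)\}$. $A$ is regarded as the co-domain and $B$ as the domain of $R$. A mirrored symbol denotes the inverse relation. $R$ is co-surjective if for every $b\in B$ there is $a\in A$ with $aRb$; $R$ is co-injective if for every $a\in A$ there is $b\in B$ with $aRb$ and such that $a'Rb$ implies $a'=a$; $R$ is co-bijective if it is co-surjective and co-injective. **Graphs.** $\mathbf{Gr}$ is the category of finite reflexive graphs $(K,\sqcap)$ ($\sqcap$ reflexive and symmetric); a morphism from $L$ to $K$ is a co-bijective relation $\sqsupset\subseteq K\times L$ that is edge-preserving ($a_0\sqsupset b_0$, $a_1\sqsupset b_1$ and $b_0\sqcap b_1$ imply $a_0\sqcap a_1$); composition is composition of relations. A paracategory is defined like a category, except that the composition of two composable morphisms need not be a morphism of it. For a paracategory $\mathbf K$, $\mathbf K^A_B$ is the class of morphisms from $B$ to $A$. $\mathbf K$ is directed if for all objects $A_0,A_1$ there is an object $B$ with $\mathbf K^{A_0}_B\ne\emptyset\ne\mathbf K^{A_1}_B$. **Setting.** $\mathrm{Homeo}(X)$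 carries the supremum metric induced by $d$ (it is a Polish group). $(K_n)_{n\in\mathbb N}$ is a fixed sequence of finite minimal open covers of $X$ (no proper subfamily of $K_n$ covers $X$) such that $K_{n+1}$ refines $K_n$, every element of $K_n$ is the union of the elements of $K_{n+1}$ contained in it, and $\mathrm{mesh}(K_n)\to 0$. Each $K_n$ is viewed as a reflexive graph, with $p\sqcap q$ iff $p\cap q\neq\emptyset$. For $f\in\mathrm{Homeo}(X)$ and $m\le n$, the relation $\sqsupset_{f,m,n}\subseteq K_m\times K_n$ is given by $p\sqsupset_{f,m,n}q \iff p\supseteq f[q]$. For a subgroup $G\le\mathrm{Homeo}(X)$, $\mathbf K_G$ is the paracategory with objects $K_n$, $n\in\mathbb N$, whose morphisms from $K_n$ to $K_m$ ($m\le n$) are the co-bijective relations of the form $\sqsupset_{f,m,n}$ with $f\in G$. $\mathtt I\subseteq \mathbf K_G$ is the category with the same objects whose morphisms are all $\succeq^m_n=\sqsupset_{\mathrm{Id}_X,m,n}$, $m\le n$ (i.e. $p\succeq^m_n q$ iff $p\supseteq q$); $\preceq^m_n$ is the inverse of $\succeq^m_n$. **Digraphs.** For a sub-paracategory $\mathtt I\subseteq\mathbf L\subseteq\mathbf K_G$, the paracategory $\underline{\mathbf L}$ has as objects all triples $(K_m,\sqcap,\leftarrow)$ (denoted by $\leftarrow$), where $\leftarrow\,=\,\sqsupset\circ\preceq^m_n\ \subseteq K_m\times K_m$ for some $n\ge m$ and $\sqsupset\in\mathbf L^{K_m}_{K_n}$. A morphism in $\underline{\mathbf L}$ from an object on $K_n$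 with arrow relation $\twoheadleftarrow$ to an object on $K_m$ with arrow relation $\leftarrow$ is a morphism $\sqsupset\in\mathbf L^{K_m}_{K_n}$ that is weakly arrow-preserving: whenever $b_0\twoheadleftarrow b_1$ there are $a_0\sqsupset b_0$, $a_1\sqsupset b_1$ with $a_0\leftarrow a_1$. $G_{\mathbf L}=\{f\in\mathrm{Homeo}(X): \text{for all } m\le n,\ \sqsupset_{f,m,n}\in\mathrm{mor}(\mathbf{Gr})\Rightarrow \sqsupset_{f,m,n}\in\mathrm{mor}(\mathbf L)\}$. *)

(* Defs.v *)
From HB Require Import structures.
From mathcomp Require Import all_boot all_order all_algebra.
From mathcomp Require Import lra.
From mathcomp Require Import all_classical all_reals all_analysis.

Set Implicit Arguments.
Unset Strict Implicit.
Unset Printing Implicit Defensive.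

Import Order.TTheory GRing.Theory Num.Theory.
Import numFieldNormedType.Exports.

Local Open Scope classical_set_scope.
Local Open Scope ring_scope.

(* A relation [R] between [A : set T] (its co-domain) and [B : set U] (its
   domain) is a set of pairs; whether it is contained in [A `*` B] is stated
   separately.  The library's [S \; R] composes in the order of functions, so
   that (a, c) belongs to [S \; R] iff R (a, b) and S (b, c) for some b. *)
Definition rcomp T U V (R : set (T * U)) (S : set (U * V)) : set (T * V) :=
  (S \; R)%relation.

Definition rinv T U (R : set (T * U)) : set (U * T) := (R^-1)%relation.

Definition rdiag T (A : set T) : set (T * T) :=
  [set ab | A ab.1 /\ ab.1 = ab.2].

Section Cobijective.
Context {T U : Type} (A : set T) (B : set U) (R : set (T * U)).

Definition co_surjective := forall b, B b -> exists2 a, A a & R (a, b).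

Definition co_injective := forall a, A a -> exists b,
  [/\ B b, R (a, b) & forall a', A a' -> R (a', b) -> a' = a].

Definition co_bijective := co_surjective /\ co_injective.

End Cobijective.

Record rgraph (T : Type) := RGraph {
  vert : set T;
  adj : set (T * T);
  vert_finite : finite_set vert;
  adj_vert : adj `<=` vert `*` vert;
  adj_refl : forall a, vert a -> adj (a, a);
  adj_sym : forall a b, adj (a, b) -> adj (b, a) }.

Definition edge_preserving T U (A : rgraph T) (B : rgraph U)
    (R : set (T * U)) :=
  forall a0 a1 b0 b1, R (a0, b0) -> R (a1, b1) ->
    adj B (b0, b1) -> adj A (a0, a1).

Definition gr_morphism T U (A : rgraph T) (B : rgraph U) (R : set (T * U)) :=
  [/\ R `<=` vert A `*` vert B, co_bijective (vert A) (vert B) R &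
      edge_preserving A B R].

(* [I] indexes the objects, the object [i] being carried by [V i], and
   [hom P i j] is the class of morphisms from [j] to [i].  The composition of
   morphisms is [rcomp], under which [hom P] need not be closed. *)
Record paracat (T I : Type) (V : I -> set T) := Paracat {
  hom : I -> I -> set (set (T * T));
  hom_carrier : forall i j R, hom i j R -> R `<=` V i `*` V j;
  hom_id : forall i, hom i i (rdiag (V i)) }.

(* All sub-paracategories of interest contain the same identities, hence have
   the same objects. *)
Definition subparacat T I (V : I -> set T) (P Q : paracat V) :=
  forall i j, hom P i j `<=` hom Q i j.

Definition directed T I (V : I -> set T) (P : paracat V) :=
  forall i0 i1, exists j, hom P i0 j !=set0 /\ hom P i1 j !=set0.

Section Covers.
Context {R : realType} {X : metricType R}.

Definition diam (p : set X) : R := sup [set mdist z.1 z.2 | z in p `*` p].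

(* The suprema are over bounded sets when X is compact, and [sup set0 = 0]. *)
Definition mesh (C : set (set X)) : R := sup [set diam p | p in C].

End Covers.

Record cover_seq (R : realType) (X : metricType R) := CoverSeq {
  cov :> nat -> set (set X);
  cov_finite : forall n, finite_set (cov n);
  cov_open : forall n p, cov n p -> open p;
  cov_cover : forall n, \bigcup_(p in cov n) p = [set: X];
  cov_minimal : forall n C, C `<=` cov n ->
    \bigcup_(p in C) p = [set: X] -> C = cov n;
  cov_refine : forall n q, cov n.+1 q -> exists2 p, cov n p & q `<=` p;
  cov_union : forall n p, cov n p ->
    p = \bigcup_(q in [set q | cov n.+1 q /\ q `<=` p]) q;
  cov_mesh : mesh (cov n) @[n --> \oo] --> 0 }.

Section CoverGraph.
Context {R : realType} {X : metricType R} (K : cover_seq X).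

Lemma cov_priv n p : K n p ->
  exists2 x, p x & forall q, K n q -> q x -> q = p.
Proof.
move=> Kp; pose C := K n `\ p.
have CK : C <> K n by move=> E; have : C p; [rewrite E|case=> _; exact].
apply: contrapT => N; apply/CK/(@cov_minimal _ _ K) => [q []//|].
apply/seteqP; split=> // x _.
have : (\bigcup_(q in K n) q) x by rewrite cov_cover.
move=> [q Kq qx]; have [qp|qp] := pselect (q = p); last by exists q.
subst q; apply: contrapT => Cx; apply: N; exists x => // q Kq' qx'.
by apply: contrapT => qp; apply: Cx; exists q.
Qed.

Lemma cov_sub_eq n p q : K n p -> K n q -> q `<=` p -> q = p.
Proof.
move=> Kp Kq qp; have [x qx priv] := cov_priv Kq.
by rewrite (priv p Kp (qp _ qx)).
Qed.

Definition cov_adj n : set (set X * set X) :=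
  [set pq | [/\ K n pq.1, K n pq.2 & pq.1 `&` pq.2 !=set0]].

Lemma cov_adj_vert n : cov_adj n `<=` K n `*` K n.
Proof. by move=> [p q] []. Qed.

Lemma cov_adj_refl n p : K n p -> cov_adj n (p, p).
Proof. by move=> Kp; split=> //=; have [x px _] := cov_priv Kp; exists x. Qed.

Lemma cov_adj_sym n p q : cov_adj n (p, q) -> cov_adj n (q, p).
Proof. by move=> [/= Kp Kq pq]; split=> //=; rewrite setIC. Qed.

Definition cov_graph n : rgraph (set X) :=
  RGraph (cov_finite K n) (@cov_adj_vert n) (@cov_adj_refl n) (@cov_adj_sym n).

(* The relation is between K_m (co-domain) and K_n (domain). *)
Definition sqsup (f : X -> X) (m n : nat) : set (set X * set X) :=
  [set pq | [/\ K m pq.1, K n pq.2 & f @` pq.2 `<=` pq.1]].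

Definition succeq (m n : nat) : set (set X * set X) := sqsup id m n.

Definition preceq (m n : nat) : set (set X * set X) := rinv (succeq m n).

Lemma succeqnn n : succeq n n = rdiag (K n).
Proof.
apply/seteqP; split=> [[p q] [/= Kp Kq]|[p q] [/= Kp pq]].
  by rewrite image_id => qp; split=> //=; rewrite (cov_sub_eq Kp Kq qp).
by rewrite -pq; split=> //=; rewrite image_id.
Qed.

Lemma co_bijective_rdiag T (A : set T) : co_bijective A A (rdiag A).
Proof.
split=> [a Aa|a Aa]; first by exists a.
by exists a; split=> // a' _ [].
Qed.

Definition I_hom (m n : nat) : set (set (set X * set X)) :=
  [set S | (m <= n)%N /\ S = succeq m n].

Lemma I_hom_carrier m n S : I_hom m n S -> S `<=` K m `*` K n.
Proof. by move=> [_ ->] [p q] []. Qed.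

Lemma I_hom_id n : I_hom n n (rdiag (K n)).
Proof. by split; rewrite ?succeqnn. Qed.

Definition I_paracat : paracat K := Paracat I_hom_carrier I_hom_id.

End CoverGraph.

(* The proof of compactness is a parameter of the type because the supremum
   metric needs it. *)
Record homeo (R : realType) (X : metricType R) (cX : compact [set: X]) :=
  Homeo {
    hfun :> X -> X;
    hinv : X -> X;
    hfun_continuous : continuous hfun;
    hinv_continuous : continuous hinv;
    hfunK : cancel hfun hinv;
    hinvK : cancel hinv hfun }.

Section HomeoGroup.
Context {R : realType} {X : metricType R} {cX : compact [set: X]}.
Local Notation H := (homeo cX).

Lemma homeoP (f g : H) : (hfun f = hfun g) -> f = g.
Proof.
case: f g => [f f' cf cf' fK f'K] [g g' cg cg' gK g'K] /= fg; subst g.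
have E : f' = g' by apply/funext => x; rewrite -{1}(g'K x) fK.
by subst g'; congr Homeo; exact: Prop_irrelevance.
Qed.

HB.instance Definition _ := gen_eqMixin H.
HB.instance Definition _ := gen_choiceMixin H.

Lemma id_continuous_homeo : continuous (id : X -> X).
Proof. by move=> x; exact: cvg_id. Qed.

Definition homeo_one : H := Homeo cX id_continuous_homeo id_continuous_homeo
  (fun=> erefl) (fun=> erefl).

Definition homeo_inv (f : H) : H := Homeo cX (@hinv_continuous _ _ _ f)
  (@hfun_continuous _ _ _ f) (@hinvK _ _ _ f) (@hfunK _ _ _ f).

Lemma comp_continuous_homeo (f g : X -> X) :
  continuous f -> continuous g -> continuous (f \o g).
Proof. by move=> cf cg x; apply: continuous_comp; [exact: cg|exact: cf]. Qed.

Definition homeo_mul (f g : H) : H := Homeo cX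
  (comp_continuous_homeo (@hfun_continuous _ _ _ f) (@hfun_continuous _ _ _ g))
  (comp_continuous_homeo (@hinv_continuous _ _ _ g) (@hinv_continuous _ _ _ f))
  (can_comp (@hfunK _ _ _ f) (@hfunK _ _ _ g))
  (can_comp (@hinvK _ _ _ g) (@hinvK _ _ _ f)).

Lemma homeo_mulA : associative homeo_mul.
Proof. by move=> f g h; exact: homeoP. Qed.

Lemma homeo_mul1 : left_id homeo_one homeo_mul.
Proof. by move=> f; exact: homeoP. Qed.

Lemma homeo_1mul : right_id homeo_one homeo_mul.
Proof. by move=> f; exact: homeoP. Qed.

Lemma homeo_mulV : left_inverse homeo_one homeo_inv homeo_mul.
Proof. by move=> f; apply/homeoP/funext => x /=; exact: hfunK. Qed.

Lemma homeo_Vmul : right_inverse homeo_one homeo_inv homeo_mul.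
Proof. by move=> f; apply/homeoP/funext => x /=; exact: hinvK. Qed.

HB.instance Definition _ := isGroup.Build H
  homeo_mulA homeo_mul1 homeo_1mul homeo_mulV homeo_Vmul.

Definition sup_dist (f g : H) : R :=
  sup [set mdist (f x) (g x) | x in [set: X]].

Lemma mdist_bounded : exists M : R, forall x y : X, mdist x y <= M.
Proof.
have [[x0 _]|X0] := pselect ([set: X] !=set0); last first.
  by exists 0 => x; case: X0; exists x.
have cd : {within [set: X], continuous (fun x => mdist x0 x : R^o)}.
  apply: continuous_subspaceT => x; apply/cvgrPdist_le => e e0.
  near=> y; have : ball x e y by near: y; exact: nbhsx_ballx.
  rewrite ballEmdist /= => /ltW xye; rewrite ler_norml.
  have := metric_triangle x0 x y; have := metric_triangle x0 y x.
  by rewrite (metric_sym y x); lra.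
have [M [_ HM]] := compact_bounded (continuous_compact cd cX).
have {}HM x : mdist x0 x <= M + 1.
  by apply: le_trans (ler_norm _) (HM _ _ _ _); [rewrite ltrDl | exists x].
exists (M + 1 + (M + 1)) => x y; apply: le_trans (metric_triangle _ x0 _) _.
by rewrite lerD// metric_sym.
Unshelve. all: by end_near. Qed.

Lemma sup_dist_ub (f g : H) x : mdist (f x) (g x) <= sup_dist f g.
Proof.
apply: ub_le_sup; last by exists x.
by have [M HM] := mdist_bounded; exists M => _ [y _ <-].
Qed.

Lemma sup_dist_le (f g : H) r : 0 <= r ->
  (forall x, mdist (f x) (g x) <= r) -> sup_dist f g <= r.
Proof.
move=> r0 fgr; have [[x0 _]|X0] := pselect ([set: X] !=set0).
  by apply: ge_sup; [exists (mdist (f x0) (g x0)), x0 | move=> _ [x _ <-]].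
rewrite /sup_dist (_ : [set _ | _ in _] = set0) ?sup0//.
by apply/seteqP; split=> // t [x _ _]; case: X0; exists x.
Qed.

Lemma sup_dist_ge0 (f g : H) : 0 <= sup_dist f g.
Proof.
have [[x0 _]|X0] := pselect ([set: X] !=set0).
  exact: le_trans (mdist_ge0 _ _) (sup_dist_ub f g x0).
rewrite /sup_dist (_ : [set _ | _ in _] = set0) ?sup0//.
by apply/seteqP; split=> // t [x _ _]; case: X0; exists x.
Qed.

Lemma sup_distxx (f : H) : sup_dist f f = 0.
Proof.
apply/eqP; rewrite eq_le sup_dist_ge0 andbT.
by apply: sup_dist_le => // x; rewrite mdistxx.
Qed.

Lemma sup_dist_positivity (f g : H) : sup_dist f g = 0 -> f = g.
Proof.
move=> fg0; apply/homeoP/funext => x; apply: mdist_positivity.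
by apply/eqP; rewrite eq_le mdist_ge0 andbT -fg0 sup_dist_ub.
Qed.

Lemma sup_dist_sym (f g : H) : sup_dist f g = sup_dist g f.
Proof.
by rewrite /sup_dist; congr sup; apply: eq_imagel => x _; rewrite metric_sym.
Qed.

Lemma sup_dist_triangle (g f h : H) :
  sup_dist f h <= sup_dist f g + sup_dist g h.
Proof.
apply: sup_dist_le => [|x]; first by rewrite addr_ge0 ?sup_dist_ge0.
by apply: le_trans (metric_triangle _ (g x) _) _; rewrite lerD ?sup_dist_ub.
Qed.

HB.instance Definition _ := isMetric.Build R H
  sup_distxx sup_dist_positivity sup_dist_sym sup_dist_triangle.

End HomeoGroup.

Definition dense_subset (T : topologicalType) (A B : set T) :=
  A `<=` B /\ B `<=` closure A.

Definition conj_class (gT : groupType) (G : set gT) (g : gT) : set gT :=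
  [set (g ^ h)%g | h in G].

Definition has_dense_conj_class (R : realType) (X : metricType R)
    (cX : compact [set: X]) (G : set (homeo cX)) :=
  exists2 g, G g & dense_subset (conj_class G g) G.

Section KG.
Context {R : realType} {X : metricType R} {cX : compact [set: X]}.
Context (K : cover_seq X).

Section KGparacat.
Context (G : set (homeo cX)) (hG : group_closed (mem G)).

Definition KG_hom (m n : nat) : set (set (set X * set X)) :=
  [set S | [/\ (m <= n)%N, co_bijective (K m) (K n) S &
      exists2 f, G f & S = sqsup K f m n]].

Lemma KG_hom_carrier m n S : KG_hom m n S -> S `<=` K m `*` K n.
Proof. by move=> [_ _ [f _ ->]] [p q] []. Qed.

Lemma KG_hom_id n : KG_hom n n (rdiag (K n)).
Proof.
split=> //; first exact: co_bijective_rdiag.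
exists 1%g; last by rewrite -succeqnn.
by case: hG => /set_mem.
Qed.

Definition KG_paracat : paracat K := Paracat KG_hom_carrier KG_hom_id.

End KGparacat.

Definition GL (L : paracat K) : set (homeo cX) :=
  [set f | forall m n : nat, (m <= n)%N ->
    gr_morphism (cov_graph K m) (cov_graph K n) (sqsup K f m n) ->
    hom L m n (sqsup K f m n)].

End KG.

Section Digraphs.
Context {R : realType} {X : metricType R} {K : cover_seq X} (L : paracat K).

(* The graph structure of the triple is determined by its level. *)
Record digraph := Digraph {
  level : nat;
  arrow : set (set X * set X);
  arrowP : exists n : nat, (level <= n)%N /\
    exists2 S, hom L level n S & arrow = rcomp S (preceq K level n) }.

Definition digraph_carrier (A : digraph) : set (set X) := K (level A).

Definition weakly_arrow_preserving (A B : digraph) (S : set (set X * set X)) :=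
  forall b0 b1, arrow B (b0, b1) ->
    exists a0 a1, [/\ S (a0, b0), S (a1, b1) & arrow A (a0, a1)].

Definition digraph_hom (A B : digraph) : set (set (set X * set X)) :=
  [set S | hom L (level A) (level B) S /\ weakly_arrow_preserving A B S].

Lemma digraph_hom_carrier A B S :
  digraph_hom A B S -> S `<=` digraph_carrier A `*` digraph_carrier B.
Proof. by move=> [h _]; exact: hom_carrier h. Qed.

Lemma digraph_hom_id A : digraph_hom A A (rdiag (digraph_carrier A)).
Proof.
split=> [|b0 b1 b01]; first exact: hom_id.
have [n [_ [S LS E]]] := arrowP A.
have [K0 K1] : K (level A) b0 /\ K (level A) b1.
  by move: b01; rewrite E => -[q /= /(hom_carrier LS)[? _] []].
by exists b0, b1.
Qed.

Definition digraph_paracat : paracat digraph_carrier :=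
  Paracat digraph_hom_carrier digraph_hom_id.

End Digraphs.

(* Main.v *)
Require Import Defs.
From HB Require Import structures.
From mathcomp Require Import all_boot all_order all_algebra.
From mathcomp Require Import all_classical all_reals all_analysis.
From mathcomp Require Import lra.

Set Implicit Arguments.
Unset Strict Implicit.
Unset Printing Implicit Defensive.

Import Order.TTheory GRing.Theory Num.Theory.

Local Open Scope classical_set_scope.

(** The group G has a dense conjugacy class iff its conjugation action is
    topologically transitive: for all f0, f1 in G some g in G has conjugates
    close to f0 and to f1.  One implication is immediate; the other is a Baire
    category argument in the Polish group G ([homeo_baire],
    [homeo_separable], [conj_transitive_dense_class]).  Directedness of the
    digraphs is transitivity expressed on the covers.

    A digraph records f only through its pattern on K m: the pairs (a0, a1)
    such that some q of K n has f[q] inside a0 and q inside a1.  If h carries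
    the pattern of g weakly into the pattern of f, then for every x the points
    f (h x) and h (g x) are within a distance controlled by the mesh of K m
    and by the modulus of continuity of f, so that h g h^-1 is close to f
    ([maps_pattern_near_conj]).  Conversely, if h g h^-1 is close to f,
    compared with the Lebesgue number of K n, then h carries the pattern of g
    on a fine enough cover into the pattern of f ([near_conj_maps_pattern]).
    Hence a common upper bound of two digraphs amounts to a common g with
    conjugates close to two given homeomorphisms.

    The morphisms of L and those of its ambient paracategory are reconciled by
    density: the approximate conjugacies are open conditions on g and h
    ([near_conj_perturb]), so g and h can be moved into G_L, and for f in G_L
    the relation induced by f is a morphism of L as soon as its domain is a
    fine enough cover ([sqsup_gr_morphism]). *)

(** * Uniformity on compact metric spaces *)

Section CompactMetric.
Context {R : realType} {X : metricType R} (cX : compact [set: X]).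
Local Open Scope ring_scope.

(** Uniform continuity and the Lebesgue number of a cover are two instances:
    both ask for a uniform radius in a property that is monotone in the radius,
    and compactness provides it from local radii. *)
Lemma compact_uniform_radius (P : R -> X -> Prop) :
  (forall d e y, d <= e -> P e y -> P d y) ->
  (forall x, exists2 e, 0 < e & forall y, mdist x y < e -> P e y) ->
  exists2 e, 0 < e & forall y, P e y.
Proof.
move=> Pdec Ploc.
have [|e /= e0 He] := (compact_near_coveringP _).1 cX R (0^'+) P.
  move=> x _; have [e e0 He] := Ploc x.
  exists (ball x e, [set d | d < e]); first split => /=.
  - exact: nbhsx_ballx.
  - exact: nbhs_right_lt.
  - move=> [y d] /= [+ /ltW de]; rewrite ballEmdist /= => xye.
    exact: Pdec de (He _ xye).
exists (e / 2) => [|y]; first by rewrite divr_gt0.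
by apply: (He (e / 2)) => //=; [rewrite sub0r normrN gtr0_norm; lra | lra].
Qed.

Lemma continuous_mdist (f : X -> X) x e : continuous f -> 0 < e ->
  exists2 d, 0 < d & forall y, mdist x y < d -> mdist (f x) (f y) < e.
Proof.
move=> cf e0; have /nbhs_ballP[d /= d0 Hd] := cf x _ (nbhsx_ballx (f x) e e0).
by exists d => // y xy; move: (Hd y); rewrite !ballEmdist /=; exact.
Qed.

Lemma uniform_mdist (f : X -> X) e : continuous f -> 0 < e ->
  exists2 d, 0 < d & forall x y, mdist x y < d -> mdist (f x) (f y) < e.
Proof.
move=> cf e0.
apply: (compact_uniform_radius
  (P := fun d x => forall y, mdist x y < d -> mdist (f x) (f y) < e)).
  by move=> d d' x dd' H y xy; apply: H; exact: lt_le_trans dd'.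
move=> x; have [|d d0 Hd] := @continuous_mdist f x (e / 2) cf.
  by rewrite divr_gt0.
exists (d / 2) => [|y xy z yz]; first by rewrite divr_gt0.
have fxy := Hd y ltac:(lra).
have fxz : mdist (f x) (f z) < e / 2.
  by apply: Hd; apply: le_lt_trans (metric_triangle x y z) _; lra.
apply: le_lt_trans (metric_triangle _ (f x) _) _.
by rewrite metric_sym; lra.
Qed.

Lemma lebesgue_number (C : set (set X)) :
  (forall p, C p -> open p) -> \bigcup_(p in C) p = [set: X] ->
  exists2 e, 0 < e &
    forall x, exists2 p, C p & forall y, mdist x y < e -> p y.
Proof.
move=> oC covC.
apply: (compact_uniform_radius
  (P := fun d x => exists2 p, C p & forall y, mdist x y < d -> p y)).
  move=> d e x de [p Cp H]; exists p => // y xy.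
  by apply: H; exact: lt_le_trans de.
move=> x; have [p Cp px] : (\bigcup_(p in C) p) x by rewrite covC.
have /nbhs_ballP[e /= e0 He] := open_nbhs_nbhs (conj (oC p Cp) px).
exists (e / 2) => [|y xy]; first by rewrite divr_gt0.
exists p => // z yz; apply: He; rewrite ballEmdist /=.
by apply: le_lt_trans (metric_triangle _ y _) _; lra.
Qed.

(** The limit comes with the rate of the Cauchy estimate: any cluster point of
    the sequence will do. *)
Lemma compact_cauchy_limit (u : nat -> X) (r : nat -> R) :
  (forall n m, (n <= m)%N -> mdist (u n) (u m) <= r n) ->
  exists x, forall n, mdist (u n) x <= r n.
Proof.
move=> uC; have [x [_ clx]] : [set: X] `&` cluster (u @ \oo) !=set0.
  by apply: cX; exact: filterT.
exists x => n; apply/ler_addgt0Pr => e e0.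
have [|_ [[m /= nm <-]]] :=
    clx [set u m | m in [set m | (n <= m)%N]] (ball x e) _ (nbhsx_ballx x e e0).
  by exists n => // m /= nm; exists m.
rewrite ballEmdist /= metric_sym => /ltW mx.
by apply: le_trans (metric_triangle _ (u m) _) (lerD (uC _ _ nm) mx).
Qed.

End CompactMetric.

(** * Completeness and Baire category for homeomorphisms *)

Lemma exists_natSinv_lt (R : realType) (e : R) :
  (0 < e -> exists n, n.+1%:R^-1 < e)%R.
Proof.
move=> e0; have [N _ HN] := near_infty_natSinv_lt (PosNum e0).
by exists N; apply: HN => /=.
Qed.

Section HomeoMetric.
Context {R : realType} {X : metricType R} {cX : compact [set: X]}.
Local Notation H := (homeo cX).
Local Open Scope ring_scope.

Lemma closure_sup_dist (A : set H) f :
  closure A f <-> forall e, 0 < e -> exists2 g, A g & sup_dist f g < e.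
Proof.
split=> [clf e e0|Af B /nbhs_ballP[e /= e0 eB]].
  have [g [Ag]] := clf _ (nbhsx_ballx f e e0).
  by rewrite ballEmdist; exists g.
by have [g Ag fg] := Af e e0; exists g; split=> //; apply: eB; rewrite ballEmdist.
Qed.

(** Inversion is continuous at f because d (f^-1 x, g^-1 x) is the distance
    between the images under f^-1 of f y and g y, where y = g^-1 x. *)
Lemma sup_dist_inv (f : H) e : 0 < e ->
  exists2 d, 0 < d & forall g, sup_dist f g <= d ->
    sup_dist (homeo_inv f) (homeo_inv g) <= e.
Proof.
move=> e0; have [d d0 Hd] := uniform_mdist cX (@hinv_continuous _ _ _ f) e0.
exists (d / 2) => [|g fg]; first by rewrite divr_gt0.
apply: sup_dist_le => [|x]; first exact: ltW.
apply/ltW => /=; set y := hinv g x.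
rewrite -(hfunK f y) -(hinvK g x) -/y.
apply: Hd; rewrite metric_sym; apply: le_lt_trans (sup_dist_ub f g _) _; lra.
Qed.

Lemma uniform_limit_continuous (u : nat -> X -> X) (r : nat -> R)
    (F : X -> X) :
  (forall n, continuous (u n)) ->
  (forall n x, mdist (u n x) (F x) <= r n) ->
  (forall e, 0 < e -> exists n, r n < e) -> continuous F.
Proof.
move=> cu uF r0 x B /nbhs_ballP[e /= e0 eB].
have [n rn] := r0 (e / 3) ltac:(lra).
have [d d0 Hd] := @continuous_mdist _ _ _ x (e / 3) (cu n) ltac:(lra).
apply/nbhs_ballP; exists d => //= y; rewrite ballEmdist /= => xy.
apply: eB; rewrite ballEmdist /=.
have := metric_triangle (F x) (u n x) (F y).
have := metric_triangle (u n x) (u n y) (F y).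
have := uF n y; have := uF n x; have := Hd y xy.
by rewrite (metric_sym (F x) (u n x)); lra.
Qed.

Lemma uniform_limit_cancel (u v : nat -> X -> X) (r s : nat -> R)
    (F E : X -> X) :
  (forall n, cancel (u n) (v n)) -> continuous E ->
  (forall n x, mdist (u n x) (F x) <= r n) ->
  (forall n x, mdist (v n x) (E x) <= s n) ->
  (forall e, 0 < e -> exists n, r n < e /\ s n < e) -> cancel F E.
Proof.
move=> uK cE uF vE rs0 x; apply/esym/mdist_positivity/eqP.
rewrite eq_le mdist_ge0 andbT; apply/ler_addgt0Pr => e e0; rewrite add0r.
have [d d0 Hd] := @continuous_mdist _ _ _ (F x) (e / 2) cE ltac:(lra).
have [n [rn sn]] := rs0 (Num.min d (e / 2)) ltac:(rewrite lt_min; lra).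
rewrite !lt_min in rn sn; case/andP: rn => rn _; case/andP: sn => _ sn.
have EE : mdist (E (F x)) (E (u n x)) < e / 2.
  by apply: Hd; rewrite metric_sym; apply: le_lt_trans (uF n x) _.
have := vE n (u n x); rewrite uK.
have := metric_triangle x (E (u n x)) (E (F x)).
by rewrite (metric_sym (E (u n x)) (E (F x))); lra.
Qed.

(** The supremum metric itself is not complete; a sequence converges as soon as
    its inverses are uniformly Cauchy as well. *)
Lemma homeo_complete (f : nat -> H) (r s : nat -> R) :
  (forall n m, (n <= m)%N -> sup_dist (f n) (f m) <= r n) ->
  (forall n m, (n <= m)%N ->
    sup_dist (homeo_inv (f n)) (homeo_inv (f m)) <= s n) ->
  (forall e, 0 < e -> exists n, r n < e /\ s n < e) ->
  exists g : H, forall n, sup_dist (f n) g <= r n.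
Proof.
move=> fr fs rs0.
have [F HF] : {F & forall x n, mdist (f n x) (F x) <= r n}.
  apply: (@choice _ _ (fun x y => forall n, mdist (f n x) y <= r n)) => x.
  apply: (compact_cauchy_limit cX) => n m nm.
  exact: le_trans (sup_dist_ub _ _ x) (fr n m nm).
have [E HE] : {E & forall x n, mdist (hinv (f n) x) (E x) <= s n}.
  apply: (@choice _ _ (fun x y => forall n, mdist (hinv (f n) x) y <= s n)) => x.
  apply: (compact_cauchy_limit cX) => n m nm.
  exact: le_trans (sup_dist_ub (homeo_inv (f n)) (homeo_inv (f m)) x) (fs n m nm).
have cF : continuous F.
  apply: (@uniform_limit_continuous (fun n => f n) r) => // [n|e /rs0[n []]].
    exact: hfun_continuous.
  by exists n.
have cE : continuous E.
  apply: (@uniform_limit_continuous (fun n => hinv (f n)) s) => // [n|e /rs0[n []]].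
    exact: hinv_continuous.
  by exists n.
have FK : cancel F E.
  by apply: (@uniform_limit_cancel (fun n => f n) (fun n => hinv (f n)) r s) => //
    n; exact: hfunK.
have EK : cancel E F.
  apply: (@uniform_limit_cancel (fun n => hinv (f n)) (fun n => f n) s r) => //.
    by move=> n; exact: hinvK.
  by move=> e /rs0[n [? ?]]; exists n.
exists (Homeo cX cF cE FK EK) => n; apply: sup_dist_le => [|x]; last exact: HF.
exact: le_trans (sup_dist_ge0 _ _) (fr n n (leqnn n)).
Qed.

(** The hypothesis on O says that each O i has dense interior relative to G.
    Nested closed balls are chosen with radii so small that the inverses of the
    centres form a Cauchy sequence too, since completeness needs both. *)
Lemma homeo_baire (I : countType) (G : set H) (O : I -> set H) :
  closed G -> G !=set0 ->
  (forall i f e, G f -> 0 < e -> exists f' d, [/\ G f', 0 < d,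
     sup_dist f f' < e & forall g, G g -> sup_dist f' g <= d -> O i g]) ->
  exists2 g, G g & forall i, O i g.
Proof.
move=> cG [f0 Gf0] dO.
pose next n (x y : H * R) := [/\ G y.1, 0 < y.2,
  y.2 <= x.2 / 2, sup_dist x.1 y.1 + y.2 <= x.2 &
  forall g, G g -> sup_dist y.1 g <= y.2 ->
    sup_dist (homeo_inv x.1) (homeo_inv g) <= n.+1%:R^-1 /\
    forall i, unpickle n = Some i -> O i g].
have [step Hstep] : {step & forall a : nat * (H * R),
    G a.2.1 -> 0 < a.2.2 -> next a.1 a.2 (step a)}.
  apply: (@choice _ _ (fun a b => G a.2.1 -> 0 < a.2.2 -> next a.1 a.2 b)).
  move=> [n [f r]] /=; have [[Gf r0]|] := pselect (G f /\ 0 < r); last first.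
    by move=> N; exists (f, r) => Gf r0; case: N.
  have n0 : 0 < n.+1%:R^-1 :> R by rewrite invr_gt0.
  have [c c0 Hc] := sup_dist_inv f n0.
  (* The radius r / 2 keeps the new ball inside the old one, and c / 2 keeps it
     where inverses are within 1 / (n + 1) of that of f. *)
  pose e := Num.min (c / 2) (r / 2).
  have e0 : 0 < e by rewrite lt_min; lra.
  have [ec er] : e <= c / 2 /\ e <= r / 2.
    by split; rewrite /e ge_min lexx ?orbT.
  have [f' [d [Gf' d0 ff' Hd]]] : exists f' d, [/\ G f', 0 < d,
      sup_dist f f' < e & forall g, G g -> sup_dist f' g <= d ->
        forall i, unpickle n = Some i -> O i g].
    case: (unpickle n) => [i|]; last first.
      by exists f, 1; split=> //; rewrite sup_distxx.
    have [f' [d [Gf' d0 ff' Hd]]] := dO i f e Gf e0.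
    by exists f', d; split=> // g Gg fg _ [<-]; exact: Hd.
  pose d' := Num.min d e.
  have d'0 : 0 < d' by rewrite lt_min d0.
  have [d'd d'e] : d' <= d /\ d' <= e.
    by split; rewrite /d' ge_min lexx ?orbT.
  exists (f', d') => _ _; split=> //=; [lra|lra|].
  move=> g Gg f'g; split; last by apply: Hd => //; exact: le_trans d'd.
  apply: Hc; have := sup_dist_triangle f' f g; lra.
have [x [x0 xS]] : exists x : nat -> H * R,
    x 0%N = (f0, 1) /\ forall n, x n.+1 = step (n, x n).
  by exists (fix x n := if n is m.+1 then step (m, x m) else (f0, 1 : R)).
have Hx n : G (x n).1 /\ 0 < (x n).2.
  elim: n => [|n [Gn rn]]; first by rewrite x0.
  by rewrite xS; have [] := Hstep (n, x n) Gn rn.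
have nextx n : next n (x n) (x n.+1).
  by have [Gn rn] := Hx n; rewrite xS; exact: (Hstep (n, x n)).
have xle n m : (n <= m)%N -> sup_dist (x n).1 (x m).1 + (x m).2 <= (x n).2.
  elim: m => [|m IH]; first by rewrite leqn0 => /eqP ->; rewrite sup_distxx add0r.
  rewrite leq_eqVlt => /predU1P[->|/IH]; first by rewrite sup_distxx add0r.
  have [_ _ _ + _] := nextx m.
  have := sup_dist_triangle (x m).1 (x n).1 (x m.+1).1; lra.
have xle' n m : (n <= m)%N -> sup_dist (x n).1 (x m).1 <= (x n).2.
  by move=> /xle; have [_] := Hx m; lra.
have x2 n : (x n).2 <= n.+1%:R^-1.
  suff : (x n).2 <= (2 ^+ n)^-1.
    move=> /le_trans; apply; rewrite lef_pV2 ?posrE// ?exprn_gt0//.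
    by rewrite -natrX ler_nat ltn_expl.
  elim: n => [|n IH]; first by rewrite expr0 invr1 x0.
  have [_ _ + _ _] := nextx n; rewrite exprS invfM; lra.
(* The sequence is shifted by one because the bound on inverses obtained at
   step n holds on the next ball. *)
have [|||g Hg] := @homeo_complete (fun n => (x n.+1).1) (fun n => (x n.+1).2)
    (fun n => 2 * n.+1%:R^-1).
- by move=> n m nm; exact: xle'.
- move=> n m nm; have [_ _ _ _ Hn] := nextx n.
  have [Gm1 _] := Hx m.+1; have [Gn1 rn1] := Hx n.+1.
  have [H1 _] := Hn _ Gm1 (xle' n.+1 m.+1 nm).
  have [H2 _] := Hn _ Gn1 ltac:(rewrite sup_distxx; exact: ltW).
  apply: le_trans (sup_dist_triangle (homeo_inv (x n).1) _ _) _.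
  by rewrite [X in X + _]sup_dist_sym mulr_natl mulr2n lerD.
- move=> e e0; have [n Hn] := exists_natSinv_lt (ltac:(lra) : 0 < e / 2).
  have xn : (x n.+1).2 <= n.+1%:R^-1.
    by apply: le_trans (x2 n.+1) _; rewrite lef_pV2 ?posrE// ler_nat.
  by exists n; move: (n.+1%:R^-1) Hn xn => a; rewrite /=; split; lra.
have Gg : G g.
  apply: cG; apply/closure_sup_dist => e e0.
  have [n Hn] := exists_natSinv_lt e0.
  exists (x n.+1).1; first by have [] := Hx n.+1.
  rewrite sup_dist_sym; apply: le_lt_trans (Hg n) _; apply: le_lt_trans Hn.
  by apply: le_trans (x2 n.+1) _; rewrite lef_pV2 ?posrE// ler_nat.
exists g => // i.
have [_ _ _ _ Hn] := nextx (pickle i).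
by have [_] := Hn g Gg (Hg _); apply; exact: pickleK.
Qed.
End HomeoMetric.

(** * Relations induced by homeomorphisms on fine covers *)

Section CoverSequence.
Context {R : realType} {X : metricType R} {cX : compact [set: X]}.
Context (K : cover_seq X).
Local Notation H := (homeo cX).
Local Open Scope ring_scope.


Lemma cov_mdist_lt e : 0 < e -> exists N, forall n, (N <= n)%N ->
  forall p x y, K n p -> p x -> p y -> mdist x y < e.
Proof.
move=> e0; have [M HM] := mdist_bounded (cX := cX).
have /cvgrPdist_lt /(_ e e0) [N _ HN] := cov_mesh K.
exists N => n Nn p x y Kp px py; apply: le_lt_trans (HN n Nn).
rewrite sub0r normrN; apply: le_trans (ler_norm _).
have diamM (q : set X) : diam q <= Num.max M 0.
  have [->|/set0P[z qz]] := eqVneq q set0.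
    by rewrite /diam set0X image_set0 sup0 le_max lexx orbT.
  apply: ge_sup; first by exists (mdist z z), (z, z).
  by move=> _ [[u v] _ <-]; rewrite le_max HM.
apply: (@le_trans _ _ (diam p)).
  apply: ub_le_sup; last by exists (x, y).
  by exists M => _ [z _ <-].
apply: ub_le_sup; last by exists p.
by exists (Num.max M 0) => _ [q _ <-].
Qed.

Lemma cov_coarsen m n q : (m <= n)%N -> K n q -> exists2 p, K m p & q `<=` p.
Proof.
elim: n q => [|n IH] q; first by rewrite leqn0 => /eqP ->; exists q.
rewrite leq_eqVlt => /predU1P[-> Kq|mn Kq]; first by exists q.
have [q' Kq' qq'] := cov_refine Kq.
by have [p Kp q'p] := IH q' mn Kq'; exists p => //; exact: subset_trans q'p.
Qed.

Lemma cov_mem n x : exists2 p, K n p & p x.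
Proof.
have : (\bigcup_(p in K n) p) x by rewrite cov_cover.
by case=> p; exists p.
Qed.

(** For q fine enough, f[q] fits in a ball whose radius is a Lebesgue number of
    [K m], whence co-surjectivity.  For co-injectivity, a point x that lies in p
    alone forces p on every member of [K m] that contains x, in particular on
    the one that contains the Lebesgue ball around x; so the same radius
    works.  Edges are preserved because images of common points are common. *)
Lemma sqsup_gr_morphism (f : H) m : exists N, forall n, (N <= n)%N ->
  (m <= n)%N /\ gr_morphism (cov_graph K m) (cov_graph K n) (sqsup K f m n).
Proof.
have [e e0 He] := lebesgue_number cX (@cov_open _ _ K m) (cov_cover K m).
have [d d0 Hd] := uniform_mdist cX (@hfun_continuous _ _ _ f) e0.
have [N HN] := cov_mdist_lt d0.
exists (maxn m N) => n; rewrite geq_max => /andP[mn Nn]; split=> //; split.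
- by move=> [p q] [].
- split=> [q Kq|p Kp].
    have [y qy _] := cov_priv Kq; have [p Kp Hp] := He (f y).
    exists p => //; split=> // _ [z qz <-]; apply/Hp/Hd; exact: HN Kq _ _.
  have [x px xpriv] := cov_priv Kp; have [q Kq qx] := cov_mem n (hinv f x).
  have [p' Kp' Hp'] := He x.
  have p'p : p' = p by apply: xpriv => //; apply: Hp'; rewrite mdistxx.
  exists q; split=> //.
    split=> // _ [z qz <-]; rewrite -p'p; apply: Hp'.
    by rewrite -[x](hinvK f); apply: Hd; exact: HN Kq _ _.
  move=> a Ka [_ _ fqa]; apply: xpriv => //.
  by apply: fqa; exists (hinv f x) => //; exact: hinvK.
- move=> p0 p1 q0 q1 [/= Kp0 Kq0 fq0] [/= Kp1 _ fq1] [/= _ _ [x [q0x q1x]]].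
  by split=> //=; exists (f x); split; [apply: fq0 | apply: fq1]; exists x.
Qed.
End CoverSequence.

(** * Separability *)

Section Separable.
Context {R : realType} {X : metricType R} {cX : compact [set: X]}.
Context (K : cover_seq X).
Local Notation H := (homeo cX).
Local Open Scope ring_scope.

Lemma sup_dist_sqsup e : 0 < e -> exists m, forall (f g : H) n,
  gr_morphism (cov_graph K m) (cov_graph K n) (sqsup K f m n) ->
  sqsup K f m n = sqsup K g m n -> sup_dist f g < e.
Proof.
move=> e0; have [m Hm] := cov_mdist_lt (cX := cX) K (ltac:(lra) : 0 < e / 2).
exists m => f g n [_ [fsurj _] _] fg.
suff : sup_dist f g <= e / 2 by lra.
apply: sup_dist_le => [|x]; first lra.
have [q Kq qx] := cov_mem K n x; have [p Kp pq] := fsurj q Kq.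
have [_ _ fqp] := pq; move: pq; rewrite fg => -[_ _ gqp].
apply/ltW; apply: (Hm m (leqnn m) p) => //; first by apply: fqp; exists x.
by apply: gqp; exists x.
Qed.

(** A homeomorphism is determined up to a small error by the relation that it
    induces between two suitable levels, and there are only countably many
    finite relations between members of the covers. *)
Lemma homeo_separable (G : set H) : G !=set0 ->
  exists u : nat -> H, (forall n, G (u n)) /\
    forall f e, G f -> 0 < e -> exists n, sup_dist f (u n) < e.
Proof.
move=> [f0 Gf0].
have [c Hc] : {c : nat * nat * set (set X * set X) -> H & forall a,
    G (c a) /\ forall f, G f -> sqsup K f a.1.1 a.1.2 = a.2 ->
      sqsup K (c a) a.1.1 a.1.2 = a.2}.
  apply: (@choice _ _ (fun a h => G h /\ forall f, G f ->
    sqsup K f a.1.1 a.1.2 = a.2 -> sqsup K h a.1.1 a.1.2 = a.2)) => a.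
  have [[f [Gf fa]]|N] := pselect (exists f, G f /\ sqsup K f a.1.1 a.1.2 = a.2).
    by exists f.
  by exists f0; split=> // f Gf fa; case: N; exists f.
pose D := \bigcup_(mn in [set: nat * nat])
  [set c (mn, S) | S in [set S | S `<=` K mn.1 `*` K mn.2 /\ finite_set S]].
have cD : countable D.
  apply: bigcup_countable => // mn _.
  apply: sub_countable (card_image_le _ _) _.
  apply: countable_finite_subset; apply: finite_set_countable.
  by apply: finite_setX; exact: cov_finite.
have sD m n f : G f -> exists2 g, D g & sqsup K f m n = sqsup K g m n.
  move=> Gf; exists (c (m, n, sqsup K f m n)).
    exists (m, n) => //; exists (sqsup K f m n) => //; split.
      by move=> [p q] [].
    apply: sub_finite_set (finite_setX (cov_finite K m) (cov_finite K n)).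
    by move=> [p q] [].
  by have [_ /(_ f Gf erefl)] := Hc (m, n, sqsup K f m n).
have /pfcard_geP[D0|[u]] := cD.
  by have [g] := sD 0%N 0%N f0 Gf0; rewrite D0.
exists u; split=> [n|f e Gf e0].
  by have [mn _ [S _ <-]] : D (u n) by [exact: funS]; have [] := Hc (mn, S).
have [m Hm] := sup_dist_sqsup e0.
have [n /(_ n (leqnn n))[_ fgr]] := sqsup_gr_morphism K f m.
have [g Dg fg] := sD m n f Gf.
have [k _ kg] : (u @` setT) g by exact: (@surj _ _ _ _ u).
by exists k; rewrite kg; exact: Hm fgr fg.
Qed.

End Separable.

(** * Approximate conjugacy and dense conjugacy classes *)

Section Conjugacy.
Context {R : realType} {X : metricType R} {cX : compact [set: X]}.
Local Notation H := (homeo cX).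
Local Open Scope ring_scope.

(** This says that f is within e of h g h^-1, in a form that avoids the
    inverse of h. *)
Definition near_conj e (f h g : X -> X) :=
  forall x, mdist (f (h x)) (h (g x)) < e.

(** For A = G this is the topological transitivity of the conjugation action of
    G on itself: some conjugacy class meets any two given open sets.
    A smaller A allows this to be verified on a dense subset. *)
Definition conj_transitive (A G : set H) := forall (f0 f1 : H) e,
  A f0 -> A f1 -> 0 < e -> exists g h0 h1, [/\ G g, G h0, G h1,
    near_conj e f0 h0 g & near_conj e f1 h1 g].

Lemma near_conj_sup_dist e (f f' h g : H) : near_conj e f' h g ->
  forall e', sup_dist f f' < e' -> near_conj (e' + e) f h g.
Proof.
move=> cg e' ff' x; have := cg x; have := sup_dist_ub f f' (h x).
by have := metric_triangle (f (h x)) (f' (h x)) (h (g x)); lra.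
Qed.

Lemma conj_transitive_dense (A G : set H) : G `<=` closure A ->
  conj_transitive A G -> conj_transitive G G.
Proof.
move=> GA tA f0 f1 e /GA/closure_sup_dist Gf0 /GA/closure_sup_dist Gf1 e0.
have e2 : 0 < e / 2 by lra.
have [a0 Aa0 fa0] := Gf0 _ e2; have [a1 Aa1 fa1] := Gf1 _ e2.
have [g [h0 [h1 [Gg Gh0 Gh1 c0 c1]]]] := tA a0 a1 (e / 2) Aa0 Aa1 e2.
by exists g, h0, h1; split=> //; rewrite [e]splitr; exact: near_conj_sup_dist.
Qed.

(** Approximate conjugacy is an open condition on h and g.  This is what allows
    both to be replaced by members of a dense set. *)
Lemma near_conj_perturb e (f h g : H) : near_conj e f h g ->
  forall e', e < e' -> exists2 d, 0 < d & forall h' g', sup_dist h h' < d ->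
    sup_dist g g' < d -> near_conj e' f h' g'.
Proof.
move=> cg e' ee'; pose r := (e' - e) / 3; have r0 : 0 < r by rewrite /r; lra.
have [d d0 Hd] := uniform_mdist cX (@hfun_continuous _ _ _ f) r0.
have [d' d'0 Hd'] := uniform_mdist cX (@hfun_continuous _ _ _ h) r0.
exists (Num.min r (Num.min d d')) => [|h' g']; first by rewrite !lt_min r0 d0.
rewrite !lt_min => /and3P[hr hd hd'] /and3P[gr gd gd'] x.
have t1 : mdist (f (h' x)) (f (h x)) < r.
  by apply: Hd; rewrite metric_sym; exact: le_lt_trans (sup_dist_ub h h' x) hd.
have t2 : mdist (h (g x)) (h (g' x)) < r.
  by apply: Hd'; exact: le_lt_trans (sup_dist_ub g g' x) gd'.
have t3 := sup_dist_ub h h' (g' x).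
have := cg x.
have := metric_triangle (f (h' x)) (f (h x)) (h' (g' x)).
have := metric_triangle (f (h x)) (h (g x)) (h' (g' x)).
have := metric_triangle (h (g x)) (h (g' x)) (h' (g' x)).
by rewrite /r in hr t1 t2; lra.
Qed.

Lemma conj_class_closureP (G : set H) (g f : H) : group_closed (mem G) ->
  closure (conj_class G g) f <->
  forall e, 0 < e -> exists2 h, G h & near_conj e f h g.
Proof.
move=> hG; have GV h : G h -> G (homeo_inv h).
  by move=> /mem_set Gh; apply: set_mem; exact: (group_closedV hG).
rewrite closure_sup_dist; split=> Hf e e0.
  have [_ [h Gh <-] fh] := Hf e e0; exists (homeo_inv h); first exact: GV.
  move=> x; have := le_lt_trans (sup_dist_ub f (g ^ h)%g (hinv h x)) fh.
  by rewrite /= hinvK.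
have [h Gh c] := Hf (e / 2) ltac:(lra).
exists (g ^ (homeo_inv h))%g; first by exists (homeo_inv h) => //; exact: GV.
suff : sup_dist f (g ^ homeo_inv h)%g <= e / 2 by lra.
apply: sup_dist_le => [|x]; first lra.
by have := c (hinv h x); rewrite hinvK => /ltW.
Qed.

(** The g that have a conjugate within 1/(k+1) of the j-th term of a dense
    sequence form an open set, and transitivity makes it dense: a conjugate of
    the common g lies near any prescribed f.  A g in all of these sets has a
    dense class. *)
Lemma conj_transitive_dense_class (K : cover_seq X) (G : set H) :
  group_closed (mem G) -> closed G -> conj_transitive G G ->
  has_dense_conj_class G.
Proof.
move=> hG cG tG.
have G1 : G !=set0 by exists 1%g; case: hG => /set_mem.
have GM f g : G f -> G g -> G (homeo_mul f g).
  by move=> /mem_set Gf /mem_set Gg; apply: set_mem; exact: (group_closedM hG).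
have GV f : G f -> G (homeo_inv f).
  by move=> /mem_set Gf; apply: set_mem; exact: (group_closedV hG).
have [u [Gu uD]] := homeo_separable K G1.
pose O (i : nat * nat) := [set g : H |
  exists2 h, G h & near_conj (i.2.+1%:R^-1) (u i.1) h g].
have [|g Gg Og] := @homeo_baire _ _ _ (nat * nat)%type G O cG G1.
  move=> [j k] f e Gf e0.
  have k0 : 0 < k.+1%:R^-1 :> R by rewrite invr_gt0.
  pose r := Num.min (e / 2) (k.+1%:R^-1 / 2).
  have r0 : 0 < r by rewrite lt_min; move: (k.+1%:R^-1) k0 => a a0; lra.
  have [g [h0 [h1 [Gg Gh0 Gh1 c0 c1]]]] := tG f (u j) r Gf (Gu j) r0.
  (* This conjugate of g is close to f, and its conjugate by h = h1 h0^-1 is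
     h1 g h1^-1, which is close to u j. *)
  pose f' : H := homeo_mul h0 (homeo_mul g (homeo_inv h0)).
  pose h : H := homeo_mul h1 (homeo_inv h0).
  have cf' : near_conj r (u j) h f'.
    by move=> x /=; rewrite hfunK; exact: c1.
  have rk : r < k.+1%:R^-1.
    rewrite /r gt_min; apply/orP; right.
    by move: (k.+1%:R^-1) k0 => a a0; lra.
  have [d d0 Hd] := near_conj_perturb cf' rk.
  have Gf' : G f' by apply: (GM) => //; apply: (GM) => //; exact: GV.
  exists f', (d / 2); split=> //; first by lra.
    have : sup_dist f f' <= r; last first.
      by move/le_lt_trans; apply; rewrite gt_min; apply/orP; left; lra.
    apply: sup_dist_le => [|x]; first exact: ltW.
    by have := c0 (hinv h0 x); rewrite hinvK => /ltW.
  move=> g' Gg' f'g'; exists h; first by apply: GM => //; exact: GV.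
  by apply: Hd; rewrite ?sup_distxx//; lra.
exists g => //; split=> [_ [h Gh <-]|f Gf].
  by apply: (GM); [exact: GV | exact: GM].
apply/(conj_class_closureP _ _ hG) => e e0.
have e2 : 0 < e / 2 by lra.
have [j fj] := uD f _ Gf e2; have [k ke] := exists_natSinv_lt e2.
have [h Gh c] := Og (j, k); exists h => // x.
have := near_conj_sup_dist c fj x => /=.
by move: (k.+1%:R^-1) ke => a ae; lra.
Qed.

End Conjugacy.

(** * Digraph morphisms as approximate conjugacies *)

Section DigraphMorphisms.
Context {R : realType} {X : metricType R} {cX : compact [set: X]}.
Context (K : cover_seq X).
Local Notation H := (homeo cX).
Local Open Scope ring_scope.

(** This is the arrow relation of a digraph on [K m] whose underlying relation
    is induced by f. *)
Definition pattern (f : X -> X) m n := rcomp (sqsup K f m n) (preceq K m n).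

Lemma patternP f m n a0 a1 : pattern f m n (a0, a1) <->
  [/\ K m a0, K m a1 & exists q, [/\ K n q, f @` q `<=` a0 & q `<=` a1]].
Proof.
split=> [[q /= [Ka0 Kq fq] [Ka1 _]]|[Ka0 Ka1 [q [Kq fq qa1]]]].
  by rewrite image_id => qa1; split=> //; exists q.
by exists q; split=> //=; rewrite image_id.
Qed.

Definition maps_pattern (f h g : X -> X) m n k l := forall b0 b1,
  pattern g k l (b0, b1) -> exists a0 a1,
    [/\ sqsup K h m k (a0, b0), sqsup K h m k (a1, b1) &
        pattern f m n (a0, a1)].

(** Choose q containing x, members b0 of [K k] around g[q] and b1 around q.
    The arrow from b0 to b1 is witnessed in the pattern of f by some y such
    that y and h x share a member of [K m], and so do f y and h (g x). *)
Lemma maps_pattern_near_conj (f : H) e : 0 < e ->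
  exists m, forall (g h : H) n k l, (k <= l)%N ->
    co_surjective (K k) (K l) (sqsup K g k l) ->
    maps_pattern f h g m n k l -> near_conj e f h g.
Proof.
move=> e0; have e2 : 0 < e / 2 by lra.
have [d d0 Hd] := uniform_mdist cX (@hfun_continuous _ _ _ f) e2.
have [m Hm] : exists m, forall p x y, K m p -> p x -> p y ->
    mdist x y < Num.min d (e / 2).
  have [|m Hm] := cov_mdist_lt (cX := cX) K (_ : 0 < Num.min d (e / 2)).
    by rewrite lt_min d0.
  by exists m; exact: Hm.
exists m => g h n k l kl gsurj hmap x.
have [q Kq qx] := cov_mem K l x; have [b0 Kb0 [_ _ gq]] := gsurj q Kq.
have [b1 Kb1 qb1] := cov_coarsen kl Kq.
have [|a0 [a1 [[/= Ka0 _ hb0] [/= Ka1 _ hb1] /patternP[_ _ [r [Kr fr ra1]]]]]] :=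
    hmap b0 b1; first by apply/patternP; split=> //; exists q.
have [y ry _] := cov_priv Kr.
have xy : mdist (h x) y < d.
  have := Hm a1 (h x) y Ka1 (hb1 _ (imageP _ (qb1 _ qx))) (ra1 _ ry).
  by rewrite lt_min => /andP[].
have ghx : a0 (h (g x)) by apply: hb0; exists (g x) => //; apply: gq; exists x.
have fya0 : a0 (f y) by apply: fr; exists y.
have := Hm a0 (f y) (h (g x)) Ka0 fya0 ghx; rewrite lt_min => /andP[_].
by have := Hd _ _ xy; have := metric_triangle (f (h x)) (f y) (h (g x)); lra.
Qed.

(** Given an arrow from b0 to b1, take x in a set q that witnesses it.  The sets
    h[b1] and f^-1[h[b0]] both lie close to h x, the second because
    f^-1 (h (g x)) does; so a single r of [K n] contains both, by the Lebesgue
    number of [K n], and r witnesses an arrow between members of [K m] around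
    h[b0] and h[b1]. *)
Lemma near_conj_maps_pattern (f : H) m n : (m <= n)%N ->
  co_surjective (K m) (K n) (sqsup K f m n) ->
  exists2 e, 0 < e & forall h g : H, near_conj e f h g ->
    exists N, forall k l, (N <= k)%N -> maps_pattern f h g m n k l.
Proof.
move=> mn fsurj.
have [c c0 Hc] := lebesgue_number cX (@cov_open _ _ K n) (cov_cover K n).
have [e e0 He] := uniform_mdist cX (@hinv_continuous _ _ _ f) c0.
exists (e / 2) => [|h g fhg]; first by lra.
have ce : 0 < Num.min c (e / 2) by rewrite lt_min c0; lra.
have [d d0 Hd] := uniform_mdist cX (@hfun_continuous _ _ _ h) ce.
have [N HN] := cov_mdist_lt (cX := cX) K d0.
exists N => k l Nk b0 b1 /patternP[Kb0 Kb1 [q [Kq gq qb1]]].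
have [x qx _] := cov_priv Kq; have [r Kr Hr] := Hc (h x).
have [a0 Ka0 [_ _ fr]] := fsurj r Kr; have [a1 Ka1 ra1] := cov_coarsen mn Kr.
exists a0, a1; split; last by apply/patternP; split=> //; exists r.
- split=> // _ [z b0z <-] /=; apply: fr; exists (hinv f (h z)); last exact: hinvK.
  apply: Hr; rewrite -(hfunK f (h x)); apply: He.
  have b0gx : b0 (g x) by apply: gq; exists x.
  have := Hd _ _ (HN k Nk b0 (g x) z Kb0 b0gx b0z); rewrite lt_min => /andP[_].
  by have := fhg x; have := metric_triangle (f (h x)) (h (g x)) (h z); lra.
- split=> // _ [z b1z <-] /=; apply/ra1/Hr.
  have := Hd _ _ (HN k Nk b1 x z Kb1 (qb1 _ qx) b1z).
  by rewrite lt_min => /andP[].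
Qed.

End DigraphMorphisms.

Theorem theorem4p2 (R : realType) (X : metricType R) (cX : compact [set: X])
    (K : cover_seq X) (G : set (homeo cX))
    (hG : group_closed (mem G)) (closedG : closed G)
    (L : paracat K)
    (IL : subparacat (I_paracat K) L) (LKG : subparacat L (KG_paracat K hG))
    (denseGL : dense_subset (GL L) G) :
  directed (digraph_paracat L) <-> has_dense_conj_class G.
Proof.
have [_ GGL] := denseGL.
have homE m n S : Defs.hom L m n S -> [/\ (m <= n)%N,
    co_surjective (K m) (K n) S & exists2 f, G f & S = sqsup K f m n].
  by move=> /LKG[mn [Ssurj _] Sf].
have GLhom (f : homeo cX) m : GL L f ->
    exists N, forall n, (N <= n)%N -> Defs.hom L m n (sqsup K f m n).
  move=> Lf; have [N HN] := sqsup_gr_morphism K f m.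
  by exists N => n /HN[mn grf]; exact: Lf.
have obj f m n : (m <= n)%N -> Defs.hom L m n (sqsup K f m n) ->
    exists2 A : digraph L, level A = m & arrow A = pattern K f m n.
  move=> mn Lf; have AP : exists n', (m <= n')%N /\ exists2 S, Defs.hom L m n' S &
      pattern K f m n = rcomp S (preceq K m n').
    by exists n; split=> //; exists (sqsup K f m n).
  by exists (@Digraph _ _ _ L m (pattern K f m n) AP).
split=> [dirL|[g0 Gg0 [_ Gg0d]]].
  apply: (conj_transitive_dense_class K hG closedG).
  apply: conj_transitive_dense GGL _ => f0 f1 e Lf0 Lf1 e0.
  have [m0 Hm0] := maps_pattern_near_conj K f0 e0.
  have [m1 Hm1] := maps_pattern_near_conj K f1 e0.
  have [n0 /(_ n0 (leqnn _)) Ln0] := GLhom f0 m0 Lf0.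
  have [n1 /(_ n1 (leqnn _)) Ln1] := GLhom f1 m1 Lf1.
  have [mn0 _ _] := homE _ _ _ Ln0; have [mn1 _ _] := homE _ _ _ Ln1.
  have [A0 lA0 aA0] := obj _ _ _ mn0 Ln0.
  have [A1 lA1 aA1] := obj _ _ _ mn1 Ln1.
  have [B [[S0 [LS0 wS0]] [S1 [LS1 wS1]]]] := dirL A0 A1.
  have [l [Bl [S LS aB]]] := arrowP B.
  have [_ Ssurj [g Gg Sg]] := homE _ _ _ LS.
  have [_ _ [h0 Gh0 Sh0]] := homE _ _ _ LS0.
  have [_ _ [h1 Gh1 Sh1]] := homE _ _ _ LS1.
  exists g, h0, h1; split=> //.
    apply: (Hm0 g h0 n0 (level B) l) => //; first by rewrite -Sg.
    move=> b0 b1; rewrite /pattern -Sg -aB => /wS0.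
    by rewrite aA0 Sh0 lA0.
  apply: (Hm1 g h1 n1 (level B) l) => //; first by rewrite -Sg.
  move=> b0 b1; rewrite /pattern -Sg -aB => /wS1.
  by rewrite aA1 Sh1 lA1.
move=> A0 A1.
have objP (A : digraph L) : exists f n, [/\ G f, (level A <= n)%N,
    arrow A = pattern K f (level A) n &
    co_surjective (K (level A)) (K n) (sqsup K f (level A) n)].
  have [n [An [S LS aA]]] := arrowP A.
  have [_ Ssurj [f Gf Sf]] := homE _ _ _ LS.
  by exists f, n; split=> //; rewrite /pattern -Sf.
have [f0 [n0 [Gf0 An0 aA0 sA0]]] := objP A0.
have [f1 [n1 [Gf1 An1 aA1 sA1]]] := objP A1.
have [e0 e00 He0] := near_conj_maps_pattern An0 sA0.
have [e1 e10 He1] := near_conj_maps_pattern An1 sA1.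
have approx (f : homeo cX) (e : R) : G f -> (0 < e)%R ->
    exists2 h : homeo cX, GL L h &
    exists2 d, (0 < d)%R & forall g, (sup_dist g0 g < d)%R -> near_conj e f h g.
  move=> Gf ep; have ep2 : (0 < e / 2)%R by lra.
  have [h Gh c] := (conj_class_closureP g0 f hG).1 (Gg0d f Gf) (e / 2)%R ep2.
  have [d dp Hd] := near_conj_perturb c (ltac:(lra) : (e / 2 < e)%R).
  move: (GGL _ Gh) => /closure_sup_dist /(_ d dp) [h' Lh' hh'].
  by exists h' => //; exists d => // g; exact: Hd.
have [h0 Lh0 [d0 d00 Hd0]] := approx f0 e0 Gf0 e00.
have [h1 Lh1 [d1 d10 Hd1]] := approx f1 e1 Gf1 e10.
have [g Lg] : exists2 g : homeo cX, GL L g & (sup_dist g0 g < Num.min d0 d1)%R.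
  move: (GGL _ Gg0) => /closure_sup_dist; apply; by rewrite lt_min d00.
rewrite lt_min => /andP[gd0 gd1].
have [N0 HN0] := He0 h0 g (Hd0 g gd0); have [N1 HN1] := He1 h1 g (Hd1 g gd1).
have [M0 HM0] := GLhom h0 (level A0) Lh0.
have [M1 HM1] := GLhom h1 (level A1) Lh1.
(* The level k serves both digraphs; l is any level from which g induces a
   morphism to level k. *)
pose k := maxn (maxn N0 N1) (maxn M0 M1).
have [[N0k N1k] [M0k M1k]] :
    ((N0 <= k) /\ (N1 <= k)) /\ ((M0 <= k) /\ (M1 <= k)).
  by rewrite !leq_max !leqnn ?orbT.
have [l /(_ l (leqnn l)) Ll] := GLhom g k Lg.
have [kl _ _] := homE _ _ _ Ll; have [B lB aB] := obj _ _ _ kl Ll.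
exists B; split.
  exists (sqsup K h0 (level A0) k); split; first by rewrite lB; exact: HM0.
  by move=> b0 b1; rewrite aB aA0; exact: HN0.
exists (sqsup K h1 (level A1) k); split; first by rewrite lB; exact: HM1.
by move=> b0 b1; rewrite aB aA1; exact: HN1.
Qed.
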